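(* $$\lim_{f\to\infty} \frac{\#\{S\mid S\text{ a numerical semigroup},\ f(S)=f,\ q(S)>3\}} {2^{\overline{f}}} =0,$$ where $f$ ranges over the positive integers.
   Context: A numerical semigroup is a subset $S\subseteq\mathbb{N}=\{0,1,2,\dots\}$ that contains $0$, is closed under addition, and has finite complement in $\mathbb{N}$. The Frobenius number $f(S)$ is the largest element of $\mathbb{N}\setminus S$, and the multiplicity $m(S)$ is the smallest non-zero element of $S$. The depth of $S$ is $q(S)=\left\lceil\frac{f(S)+1}{m(S)}\right\rceil$. $\overline{f}=\left\lfloor\frac{f-1}{2}\right\rfloor$. *)

(* Defs.v *)
From HB Require Import structures.
From mathcomp Require Import all_boot all_order all_algebra.
From mathcomp Require Import finmap.
From mathcomp Require Import all_classical all_reals all_analysis.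

Set Implicit Arguments.
Unset Strict Implicit.
Unset Printing Implicit Defensive.

Import Order.TTheory GRing.Theory Num.Theory.
Import numFieldNormedType.Exports.

Local Open Scope classical_set_scope.
Local Open Scope ring_scope.

Definition numerical_semigroup (S : set nat) : Prop :=
  [/\ S 0%N, forall x y : nat, S x -> S y -> S (x + y)%N & finite_set (~` S)].

(* The codomain is int so that the default value can be the usual convention
   -1 for S = setT, the only numerical semigroup without gaps. *)
Definition frobenius (S : set nat) : int :=
  xget (-1) [set n%:Z | n in ~` S `&` ubound (~` S)].

(* The default value 0 is never reached for a numerical semigroup. *)
Definition multiplicity (S : set nat) : nat :=
  xget 0%N ((S `\ 0%N) `&` lbound (S `\ 0%N)).

Definition depth (S : set nat) : int :=
  Num.ceil ((frobenius S + 1)%:~R / (multiplicity S)%:R : rat).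

(* The truncated subtraction differs from the integer one only at f = 0. *)
Definition fbar (f : nat) : nat := ((f - 1) %/ 2)%N.

Definition deep_semigroups (f : nat) : set (set nat) :=
  [set S | [/\ numerical_semigroup S, frobenius S = f%:Z & 3 < depth S]].

Lemma frobeniusE (S : set nat) (f : nat) :
  frobenius S = f%:Z <-> ~ S f /\ (forall n : nat, ~ S n -> (n <= f)%N).
Proof.
rewrite /frobenius; split=> [|[nSf ubf]].
  by case: xgetP => [_ -> [n [nSn ubn] <-] [<-]|] //.
apply: xget_unique => [|_ [n [nSn ubn] <-]]; first by exists f.
congr Posz; apply/eqP; rewrite eqn_leq ubf //=; exact: ubn.
Qed.

Lemma multiplicityP (S : set nat) : numerical_semigroup S ->
  [/\ S (multiplicity S), (0 < multiplicity S)%N &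
      forall n : nat, S n -> (0 < n)%N -> (multiplicity S <= n)%N].
Proof.
move=> [_ _ finS].
have [n Sn n0] : exists2 n, S n & (0 < n)%N.
  apply: contrapT => noS; apply: infinite_nat.
  apply: (@sub_finite_set _ _ (0%N |` ~` S)); last by rewrite finite_setU.
  move=> n _; have [->|n0] := eqVneq n 0%N; first by left.
  by right => Sn; apply: noS; exists n => //; rewrite lt0n.
have exS : exists n, `[< S n >] && (0 < n)%N.
  by exists n; rewrite n0 andbT; apply/asboolP.
rewrite /multiplicity; case: xgetP => [m _ [[Sm m0] lbm]|noM]; last first.
  case: (ex_minnP exS) => k /andP[/asboolP Sk k0] mink; exfalso.
  apply: (noM k); split=> [|j [Sj j0]]; first by split=> // k_eq0; rewrite k_eq0 in k0.
  apply: mink; apply/andP; split; first exact/asboolP.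
  by rewrite lt0n; apply/eqP.
split=> // [|j Sj j0]; first by rewrite lt0n; apply/eqP.
by apply: lbm; split=> // j_eq0; rewrite j_eq0 in j0.
Qed.

(* Hence fset_set (deep_semigroups f) has exactly these semigroups as elements,
   and its cardinal is their number. *)
Lemma finite_deep_semigroups (f : nat) : finite_set (deep_semigroups f).
Proof.
pose g (A : {set 'I_f.+1}) : set nat :=
  [set n | (f < n)%N \/ exists2 i : 'I_f.+1, val i = n & i \in A].
apply: (@sub_finite_set _ _ (g @` setT)); last exact/finite_image/finite_finset.
move=> S [_ /frobeniusE [_ ubf] _].
exists [set i : 'I_f.+1 | `[< S i >]]%SET => //.
apply/seteqP; split=> n.
  case=> [fn|[i <-]]; last by rewrite inE => /asboolP.
  by apply: contrapT => /ubf; rewrite leqNgt fn.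
move=> Sn; have [fn|nf] := ltnP f n; first by left.
by right; exists (Ordinal (nf : (n < f.+1)%N)) => //; rewrite inE; apply/asboolP.
Qed.

(* Main.v *)
Require Import Defs.
From HB Require Import structures.
From mathcomp Require Import all_boot all_order all_algebra.
From mathcomp Require Import finmap.
From mathcomp Require Import zify ring lra.
From mathcomp Require Import all_classical all_reals all_analysis.
Import Order.TTheory GRing.Theory Num.Theory.
Import numFieldNormedType.Exports.
Set Implicit Arguments.
Unset Strict Implicit.
Unset Printing Implicit Defensive.
Local Open Scope classical_set_scope.

(** Write m for the multiplicity and f = q m + r with 0 <= r < m; depth > 3
    means q >= 3. The semigroup is determined by its Kunz coordinates k_i, the
    least k >= 1 with i + k m in S. As f is a gap, the coordinates of two
    residues i, j with i + j = r (resp. i + j = m + r) lie in [1, Q] and have sum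
    at least Q, where Q = q + 1 (resp. Q = q). This leaves
    (Q^2 + 3 Q - 2) / 2 <= 8 (13/8)^(Q-3) choices per pair, hence about
    8^(m/2) (13/8)^((f-3m)/2) = 2^(f/2) (13/16)^((f-3m)/2) semigroups, which is
    exponentially smaller than 2^(f/2) unless f - 3m is less than L = f/30.

    In that remaining case q = 3 and almost all pairs have 8 choices. If no a in
    (L, 2L] has k_a = 1, then each of those L pairs keeps only 6 choices.
    Otherwise fix such an a: k_x = 1 implies k_(x+a) <= 2, so for x in (r, r+L]
    the pairs of x and of x + a together have 58 choices instead of 64. Summing
    over the O(f^2) values of (m, a) still leaves an exponentially small ratio. *)

(** * Counting by codes and by classes *)

(** Listing all codes of an element gives an injection of [s] into the words whose letter at [i] is
    taken from [C i]. *)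
Lemma size_le_prod_codes (T W I : eqType) (r : seq I) (s : seq T)
    (code : I -> T -> W) (C : I -> seq W) :
  uniq s ->
  (forall i x, i \in r -> x \in s -> code i x \in C i) ->
  {in s &, forall x y, (forall i, i \in r -> code i x = code i y) -> x = y} ->
  (size s <= \prod_(i <- r) size (C i))%N.
Proof.
move=> us sC inj.
pose words (r : seq I) :=
  foldr (fun i ws => [seq w :: t | w <- C i, t <- ws]) [:: [::]] r.
have sz r' : size (words r') = (\prod_(i <- r') size (C i))%N.
  elim: r' => [|i r' IH]; first by rewrite big_nil.
  by rewrite big_cons /= size_allpairs IH.
rewrite -sz -(size_map (fun x => [seq code i x | i <- r])).
apply: uniq_leq_size => [|w /mapP[x xs ->]].
  rewrite map_inj_in_uniq // => x y xs ys /eq_in_map; exact: inj.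
elim: r {inj sz} sC => [|i r IH] sC; first by rewrite inE.
apply: allpairs_f; first by apply: sC => //; rewrite mem_head.
by apply: IH => j z jr; apply: sC; rewrite in_cons jr orbT.
Qed.

Lemma size_le_classes (R : numDomainType) (T : Type) (s : seq T)
    (l : T -> nat) (M : nat) (B : R) :
  all (fun x => l x < M)%N s ->
  (forall j, (size [seq x <- s | l x == j])%:R <= B)%R ->
  ((size s)%:R <= M%:R * B)%R.
Proof.
move=> lM cB.
have -> : size s = (\sum_(j < M) size [seq x <- s | l x == j])%N.
  elim: s lM {cB} => [_|x s IH /= /andP[lx ls]]; first by rewrite big1.
  rewrite (IH ls) [in LHS](bigD1 (Ordinal lx)) // [in RHS](bigD1 (Ordinal lx)) //=.
  rewrite eqxx /= -addSn; congr (_ + _)%N.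
  apply: eq_bigr => j jx; case: eqP => // e; case/negP: jx.
  by apply/eqP/val_inj.
rewrite natr_sum mulr_natl -[M in (_ *+ M)%R]card_ord -sumr_const.
by apply: ler_sum => j _; apply: cB.
Qed.

(** * Pairs of residues and their admissible coordinates *)

(** For [i, r < m], this is the residue whose sum with [i] is congruent to [r] modulo [m]. *)
Definition partner (m r i : nat) : nat :=
  (if i <= r then r - i else m + r - i)%N.

(** With [f = q * m + r] and [i, r < m], this is the least [k] such that [i + k * m] exceeds [f]. *)
Definition kunz_cap (q r i : nat) : nat := (if i <= r then q.+1 else q)%N.

(* Counting pairs (x, y) of objects instead of objects lets every residue
   contribute one factor: the smaller residue of a pair reads off x, the larger
   one y, and a self-paired residue both. This bounds the square of the count
   and spares any bookkeeping of half-ranges. *)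
Definition pair_word (T : Type) (k : T -> nat -> nat) (m r i : nat)
    (z : T * T) : nat * nat :=
  let j := partner m r i in
  if (i < j)%N then (k z.1 i, k z.1 j)
  else if (j < i)%N then (k z.2 i, k z.2 j) else (k z.1 i, k z.2 i).

(** These are the pairs in [1, Q] x [1, Q] with sum at least Q. The first entry [Q] is treated
    apart, since there the lower bound [Q - a] would admit 0. *)
Definition pair_list (Q : nat) : seq (nat * nat) :=
  [seq (Q, b) | b <- iota 1 Q] ++
  [seq (a, (Q - a + j)%N) | a <- iota 1 Q.-1, j <- iota 0 a.+1].

Lemma mem_pair_list (Q a b : nat) :
  (0 < a <= Q)%N -> (0 < b <= Q)%N -> (Q <= a + b)%N -> (a, b) \in pair_list Q.
Proof.
move=> /andP[a0 aQ] /andP[b0 bQ] Qab; rewrite mem_cat.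
have [->|aQ'] := eqVneq a Q.
  by apply/orP; left; apply/mapP; exists b => //; rewrite mem_iota; lia.
apply/orP; right; apply/allpairsPdep; exists a, (b - (Q - a))%N.
rewrite !mem_iota; split; [lia|lia|congr pair; lia].
Qed.

(** There are [Q] pairs starting with [Q] and [a + 1] pairs starting with each [a < Q]. The doubled,
    shifted form avoids division and subtraction. *)
Lemma size_pair_list (Q : nat) : (0 < Q)%N ->
  (size (pair_list Q)).*2.+2 = (Q * (Q + 3))%N.
Proof.
case: Q => // Q _; rewrite size_cat size_map size_iota size_allpairs_dep /=.
have -> : sumn [seq size (iota 0 a.+1) | a <- iota 1 Q] =
          sumn [seq a.+1 | a <- iota 1 Q].
  by congr sumn; apply: eq_map => a; rewrite size_iota.
elim: Q => // Q IH.
have -> : iota 1 Q.+1 = iota 1 Q ++ [:: Q.+1] by rewrite -(addn1 Q) iotaD add1n addn1.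
rewrite map_cat sumn_cat /=; lia.
Qed.

(** The sizes start with 8 and 13 at [Q = 3, 4], and from there on consecutive sizes have ratio at
    most 13/8. *)
Lemma pair_list_bound (Q : nat) :
  (size (pair_list Q.+3) * 8 ^ Q <= 8 * 13 ^ Q)%N.
Proof.
elim: Q => [|Q IH]; first by [].
have h1 := @size_pair_list Q.+3 isT; have h2 := @size_pair_list Q.+4 isT.
have h : (8 * size (pair_list Q.+4) <= 13 * size (pair_list Q.+3))%N.
  move: (size (pair_list Q.+3)) (size (pair_list Q.+4)) h1 h2 => u v.
  lia.
rewrite !expnS mulnCA mulnA [leqRHS]mulnCA.
apply: leq_trans (leq_mul h (leqnn _)) _.
by rewrite -mulnA leq_mul2l IH orbT.
Qed.

Lemma partner_lt (m r i : nat) : (r < m)%N -> (i < m)%N -> (partner m r i < m)%N.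
Proof. by move=> rm im; rewrite /partner; case: (leqP i r); lia. Qed.

Lemma partnerK (m r i : nat) : (r < m)%N -> (i < m)%N ->
  partner m r (partner m r i) = i.
Proof.
rewrite /partner => rm im; case: (leqP i r) => ir; first by rewrite leq_subr subKn.
by rewrite ifF; lia.
Qed.

Lemma kunz_cap_partner (m q r i : nat) : (r < m)%N -> (i < m)%N ->
  kunz_cap q r (partner m r i) = kunz_cap q r i.
Proof.
rewrite /partner /kunz_cap => rm im; case: (leqP i r) => ir; first by rewrite leq_subr.
by rewrite ifF; lia.
Qed.

(** The word at [i] and the word at its partner read different objects, each at both residues; at a
    self-paired residue one word reads both objects. *)
Lemma pair_word_inj (T : Type) (k : T -> nat -> nat) (m r : nat) (z z' : T * T) :
  (r < m)%N ->
  (forall i, (i < m)%N -> pair_word k m r i z = pair_word k m r i z') ->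
  forall i, (i < m)%N -> k z.1 i = k z'.1 i /\ k z.2 i = k z'.2 i.
Proof.
move=> rm e i im.
have := e i im; have := e _ (partner_lt rm im).
by rewrite /pair_word partnerK //; case: ltngtP => _ [e1 e2] [e3 e4].
Qed.

Lemma pair_word_low (T : Type) (k : T -> nat -> nat) (m r i : nat) (z : T * T) :
  (r < i)%N -> (i + i < m + r)%N ->
  pair_word k m r i z = (k z.1 i, k z.1 (m + r - i)%N).
Proof.
move=> ri im; rewrite /pair_word.
have -> : partner m r i = (m + r - i)%N by rewrite /partner leqNgt ri.
by rewrite ifT //; lia.
Qed.

Definition kunz_bounded (m q r : nat) (k : nat -> nat) : Prop :=
  forall i, (i < m)%N ->
    [/\ (0 < k i)%N, (k i <= kunz_cap q r i)%N &
        (kunz_cap q r i <= k i + k (partner m r i))%N].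

Lemma pair_word_mem (T : Type) (k : T -> nat -> nat) (m q r i : nat) (z : T * T) :
  (r < m)%N -> (i < m)%N ->
  kunz_bounded m q r (k z.1) -> kunz_bounded m q r (k z.2) ->
  pair_word k m r i z \in pair_list (kunz_cap q r i).
Proof.
move=> rm im b1 b2; have jm := partner_lt rm im.
have [u1 u2 u3] := b1 _ im; have [v1 v2 v3] := b2 _ im.
have := b1 _ jm; have := b2 _ jm; rewrite kunz_cap_partner //.
move=> [w1 w2 w3] [x1 x2 x3]; rewrite /pair_word.
case: ltngtP => ij; apply: mem_pair_list; rewrite ?u1 ?u2 ?v1 ?v2 ?w1 ?w2 ?x1 ?x2 //.
rewrite -ij in u3 v3; lia.
Qed.

(** * Counting families with bounded coordinates *)

Lemma size_sqr_le_pairs (T : eqType) (k : T -> nat -> nat) (m r : nat)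
    (s : seq T) (C : nat -> seq (nat * nat)) :
  (r < m)%N -> uniq s ->
  {in s &, forall x y, (forall i, (i < m)%N -> k x i = k y i) -> x = y} ->
  (forall i x y, (i < m)%N -> x \in s -> y \in s ->
    pair_word k m r i (x, y) \in C i) ->
  (size s ^ 2 <= \prod_(0 <= i < m) size (C i))%N.
Proof.
move=> rm us inj sC.
rewrite expnS expn1 -(size_allpairs pair).
apply: (size_le_prod_codes (code := pair_word k m r)).
- by apply: allpairs_uniq => // -[? ?] [? ?] _ _ [-> ->].
- move=> i z; rewrite mem_index_iota => /andP[_ im] /allpairsP[[x y] [xs ys ->]].
  exact: sC.
- move=> _ _ /allpairsP[[x y] /= [xs ys ->]] /allpairsP[[x' y'] /= [xs' ys' ->]] e.
  have {}e i : (i < m)%N -> k x i = k x' i /\ k y i = k y' i.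
    apply: (pair_word_inj (k := k) (m := m) (r := r) (z := (x, y)) (z' := (x', y'))) => // j jm.
    by apply: e; rewrite mem_index_iota.
  by congr pair; apply: inj => // i /e[].
Qed.

Lemma prod_nat_split (F : nat -> nat) (a b c : nat) (u : nat) :
  (a <= b <= c)%N -> (forall i, (a <= i < b)%N -> F i = u) ->
  (\prod_(a <= i < c) F i = u ^ (b - a) * \prod_(b <= i < c) F i)%N.
Proof.
move=> /andP[ab bc] Fu; rewrite (big_cat_nat ab bc) /=; congr (_ * _)%N.
by rewrite (eq_big_nat _ _ Fu) prod_nat_const_nat.
Qed.

Lemma kunz_count (T : eqType) (k : T -> nat -> nat) (m q r : nat) (s : seq T) :
  (r < m)%N -> uniq s ->
  {in s &, forall x y, (forall i, (i < m)%N -> k x i = k y i) -> x = y} ->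
  (forall x, x \in s -> kunz_bounded m q r (k x)) ->
  (size s ^ 2 <= size (pair_list q.+1) ^ r.+1 * size (pair_list q) ^ (m - r.+1))%N.
Proof.
move=> rm us inj sb.
apply: leq_trans (size_sqr_le_pairs (C := fun i => pair_list (kunz_cap q r i)) rm us inj _) _.
  by move=> i x y im xs ys; apply: pair_word_mem => //; apply: sb.
rewrite (@prod_nat_split _ 0 r.+1 m (size (pair_list q.+1))) //; last first.
  by move=> i /andP[_]; rewrite ltnS /kunz_cap => ->.
rewrite subn0 (@prod_nat_split _ r.+1 m m (size (pair_list q))) ?leqnn ?andbT //.
  by rewrite big_geq // muln1.
by move=> i /andP[ri _]; rewrite /kunz_cap leqNgt ri.
Qed.

Lemma kunz_count_gap (T : eqType) (k : T -> nat -> nat) (m r L : nat) (s : seq T) :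
  (r <= L)%N -> (7 * L < m)%N -> uniq s ->
  {in s &, forall x y, (forall i, (i < m)%N -> k x i = k y i) -> x = y} ->
  (forall x, x \in s -> kunz_bounded m 3 r (k x)) ->
  (forall x i, x \in s -> (L < i <= L + L)%N -> k x i <> 1%N) ->
  (size s ^ 2 <= 13 ^ r.+1 * 6 ^ L * 8 ^ (m - r.+1 - L))%N.
Proof.
move=> rL Lm us inj sb gap; have rm : (r < m)%N by lia.
pose C i := if (L < i <= L + L)%N then [seq p <- pair_list 3 | p.1 != 1%N]
            else pair_list (kunz_cap 3 r i).
apply: leq_trans (size_sqr_le_pairs (C := C) rm us inj _) _.
  move=> i x y im xs ys.
  have := pair_word_mem (z := (x, y)) rm im (sb x xs) (sb y ys).
  rewrite /C; case: ifP => // Li; rewrite mem_filter /kunz_cap ifF; last by lia.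
  move=> ->; rewrite andbT pair_word_low; [|lia|lia].
  by apply/eqP; apply: gap.
(* [pair_list 4] has 13 elements and [pair_list 3] has 8, of which two, (1, 2) and (1, 3), start
   with 1; hence the 6. *)
rewrite (@prod_nat_split _ 0 r.+1 m 13) //; last first.
  by move=> i /andP[_ ir]; rewrite /C /kunz_cap ifF ?ifT //; lia.
rewrite (@prod_nat_split _ r.+1 L.+1 m 8); [|lia|]; last first.
  by move=> i ir; rewrite /C /kunz_cap !ifF //; lia.
rewrite (@prod_nat_split _ L.+1 (L + L).+1 m 6); [|lia|]; last first.
  by move=> i ir; rewrite /C /kunz_cap ifT //; lia.
rewrite (@prod_nat_split _ (L + L).+1 m m 8); [|lia|]; last first.
  by move=> i ir; rewrite /C /kunz_cap !ifF //; lia.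
rewrite big_geq // muln1 subn0.
have -> : (m - r.+1 - L = (L.+1 - r.+1) + (m - (L + L).+1))%N by lia.
have -> : ((L + L).+1 - L.+1 = L)%N by lia.
by rewrite expnD -!mulnA leq_mul2l; apply/orP; right; rewrite mulnCA.
Qed.

(* The residues x + a carry no word of their own: they are read off together
   with x. Only the first component of a pair of objects is improved, so the
   square of the count gains 58 / 64 once per x. *)
Lemma kunz_count_shift (T : eqType) (k : T -> nat -> nat) (m r L a : nat) (s : seq T) :
  (r <= L)%N -> (7 * L < m)%N -> (L < a <= L + L)%N -> uniq s ->
  {in s &, forall x y, (forall i, (i < m)%N -> k x i = k y i) -> x = y} ->
  (forall x, x \in s -> kunz_bounded m 3 r (k x)) ->
  (forall x i, x \in s -> (i + a < m)%N -> k x i = 1%N -> (k x (i + a) <= 2)%N) ->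
  (size s ^ 2 <= 13 ^ r.+1 * 58 ^ L * 8 ^ (m - r.+1 - (L + L)))%N.
Proof.
move=> rL Lm La us inj sb shift; have rm : (r < m)%N by lia.
pose code i z := if (r < i <= r + L)%N
    then (pair_word k m r i z, pair_word k m r (i + a) z)
  else if (r + a < i <= r + a + L)%N then ((0, 0), (0, 0))%N
  else (pair_word k m r i z, (0, 0)%N).
(* Of the 8 * 8 pairs of words, 2 * 3 have first entries 1 and 3 and are excluded, which leaves
   58. *)
pose l58 := [seq w <- [seq (p, p') | p <- pair_list 3, p' <- pair_list 3] |
  ~~ ((w.1.1 == 1%N) && (w.2.1 == 3%N))].
pose C i := if (r < i <= r + L)%N then l58
  else if (r + a < i <= r + a + L)%N then [:: ((0, 0), (0, 0))]%N
  else [seq (p, (0, 0)%N) | p <- pair_list (kunz_cap 3 r i)].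
have pw i x y : (i < m)%N -> x \in s -> y \in s ->
    pair_word k m r i (x, y) \in pair_list (kunz_cap 3 r i).
  by move=> im xs ys; apply: pair_word_mem => //; apply: sb.
have le : (size s ^ 2 <= \prod_(0 <= i < m) size (C i))%N.
  rewrite expnS expn1 -(size_allpairs pair).
  apply: (size_le_prod_codes (code := code)).
  - by apply: allpairs_uniq => // -[? ?] [? ?] _ _ [-> ->].
  - move=> i z; rewrite mem_index_iota => /andP[_ im] /allpairsP[[x y] /= [xs ys ->]].
    rewrite /code /C; case: ifP => ri.
      rewrite mem_filter; apply/andP; split.
        (* Both words read the first object: [i] and [i + a] are the smaller residues of their
           pairs, as [2 (i + a) <= 2 r + 6 L < m + r]. This uses [7 L < m]. *)
        rewrite !pair_word_low /=; [|lia..].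
        apply/negP => /andP[/eqP e1 /eqP e3].
        by have := shift x i xs; rewrite e1 e3; lia.
      have := pw i x y im xs ys; have := pw (i + a)%N x y _ xs ys.
      rewrite /kunz_cap !ifF; [|lia|lia] => h1 h2.
      by apply: allpairs_f => //; apply: h1; lia.
    case: ifP => [_|_]; first by rewrite mem_head.
    by apply: map_f; apply: pw.
  - move=> _ _ /allpairsP[[x y] /= [xs ys ->]] /allpairsP[[x' y'] /= [xs' ys' ->]] e.
    have {}e i : (i < m)%N -> k x i = k x' i /\ k y i = k y' i.
      apply: (pair_word_inj (k := k) (m := m) (r := r) (z := (x, y)) (z' := (x', y'))) => // j jm.
      have [jX|/negbTE jX] := boolP (r < j <= r + L)%N.
        by have := e j; rewrite mem_index_iota /code jX => /(_ jm)[].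
      have [jY|/negbTE jY] := boolP (r + a < j <= r + a + L)%N.
        (* The word at [j] is the second entry of the code at [j - a]. *)
        have jaX : (r < j - a <= r + L)%N by lia.
        have jam : (0 <= j - a < m)%N by lia.
        have := e (j - a)%N; rewrite mem_index_iota /code jaX => /(_ jam)[_].
        by rewrite subnK //; lia.
      by have := e j; rewrite mem_index_iota /code jX jY => /(_ jm)[].
    by congr pair; apply: inj => // i /e[].
apply: leq_trans le _.
rewrite (@prod_nat_split _ 0 r.+1 m 13) //; last first.
  by move=> i ir; rewrite /C !ifF ?size_map /kunz_cap ?ifT //; lia.
rewrite (@prod_nat_split _ r.+1 (r + L).+1 m 58); [|lia|]; last first.
  by move=> i ir; rewrite /C ifT //; lia.
rewrite (@prod_nat_split _ (r + L).+1 (r + a).+1 m 8); [|lia|]; last first.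
  by move=> i ir; rewrite /C !ifF ?size_map /kunz_cap ?ifF //; lia.
rewrite (@prod_nat_split _ (r + a).+1 (r + a + L).+1 m 1); [|lia|]; last first.
  by move=> i ir; rewrite /C ifF ?ifT //; lia.
rewrite (@prod_nat_split _ (r + a + L).+1 m m 8); [|lia|]; last first.
  by move=> i ir; rewrite /C !ifF ?size_map /kunz_cap ?ifF //; lia.
rewrite big_geq // muln1 subn0 exp1n mul1n.
have -> : (m - r.+1 - (L + L) = ((r + a).+1 - (r + L).+1) + (m - (r + a + L).+1))%N.
  by lia.
have -> : ((r + L).+1 - r.+1 = L)%N by lia.
by rewrite expnD -!mulnA.
Qed.

(** * Kunz coordinates of deep semigroups *)

(** Trying the values 1 to [f + 1] suffices when [m > 0], since [i + (f + 1) * m] exceeds [f]. *)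
Definition kunz (m f : nat) (S : set nat) (i : nat) : nat :=
  (find (fun j => `[< S (i + j.+1 * m)%N >]) (iota 0 f.+1)).+1.

(** Closure under adding [m] makes membership upward closed along a residue class, so the least
    index decides it. *)
Lemma kunzP (m f : nat) (S : set nat) (i j : nat) :
  (0 < m)%N -> (forall n, (f < n)%N -> S n) -> (forall n, S n -> S (n + m)%N) ->
  (0 < j)%N -> S (i + j * m)%N <-> (kunz m f S i <= j)%N.
Proof.
move=> m0 Sf Sm; case: j => // j _; rewrite /kunz.
set p := fun j => _; split=> [Sj|].
  rewrite ltnS leqNgt; apply/negP => jp.
  have jf : (j < f.+1)%N.
    by apply: leq_trans jp _; rewrite -[leqRHS](size_iota 0 f.+1) find_size.
  have := before_find 0%N jp; rewrite nth_iota // add0n.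
  by move/negP; apply; apply/asboolP.
have hp : has p (iota 0 f.+1).
  apply/hasP; exists f; first by rewrite mem_iota; lia.
  by apply/asboolP/Sf; nia.
have := nth_find 0%N hp; rewrite nth_iota; last first.
  by rewrite -[ltnRHS](size_iota 0 f.+1) -has_find.
rewrite add0n; move: (find _ _) => k /asboolP Sk.
rewrite ltnS => /subnK <-; elim: (j - k)%N => // t IH.
by have := Sm _ IH; rewrite addSn -addnA -mulSnr.
Qed.

Lemma deepP (f : nat) (S : set nat) : deep_semigroups f S ->
  [/\ (0 < multiplicity S)%N, (3 * multiplicity S <= f)%N,
      S (multiplicity S) /\
      (forall n, S n -> (0 < n)%N -> (multiplicity S <= n)%N),
      ~ S f & (forall n, (f < n)%N -> S n)] /\
  (S 0%N /\ forall x y, S x -> S y -> S (x + y)%N).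
Proof.
move=> [nsS /[dup] fS /frobeniusE[nSf fmax] dS].
have [Sm m0 mmin] := multiplicityP nsS; have [S0 Sadd _] := nsS.
split=> //; split=> //; last first.
  by move=> n fn; apply: contrapT => /fmax; rewrite leqNgt fn.
(* The ceiling exceeds 3 exactly when its argument does, so [f + 1 > 3 m], that is [3 m <= f]. *)
move: dS; rewrite /depth fS ceil_gt_int ltr_pdivlMr ?ltr0n //.
rewrite (_ : 3%:~R * _ = (3 * multiplicity S)%:~R :> rat)%R; last by rewrite PoszM intrM.
by rewrite ltr_int; lia.
Qed.

Lemma kunz_bounded_deep (f : nat) (S : set nat) : deep_semigroups f S ->
  kunz_bounded (multiplicity S) (f %/ multiplicity S) (f %% multiplicity S)
    (kunz (multiplicity S) f S).
Proof.
move=> /deepP; move: (multiplicity S) => m [[m0 m3 [Sm _] nSf Sf] [_ Sadd]] i im.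
have kP i' j : (0 < j)%N -> S (i' + j * m)%N <-> (kunz m f S i' <= j)%N.
  by apply: kunzP => // n Sn; apply: Sadd.
have k0 i' : (0 < kunz m f S i')%N by [].
have rm := ltn_pmod f m0; have ef := divn_eq f m.
have q3 : (3 <= f %/ m)%N by rewrite leq_divRL.
move: (f %/ m)%N (f %% m)%N rm ef q3 => q r rm ef q3.
split=> //; rewrite /kunz_cap.
  case: (leqP i r) => ir; [apply/(kP i q.+1 isT)|apply/(kP i q (ltnW (ltnW q3)))];
    by apply: Sf; rewrite ef ?mulSn; lia.
(* Write [Q] for the cap and [j] for the partner of [i]. If the coordinates satisfied [u + v < Q],
   then [v <= Q - 1 - u], so [i + u m] and [j + (Q - 1 - u) m] would both lie in [S]; their sum is
   the gap [f]. *)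
rewrite leqNgt; apply/negP; move: (kP i) (kP (partner m r i)).
move: (k0 i) (k0 (partner m r i)).
move: (kunz m f S i) (kunz m f S (partner m r i)) => u v u0 v0 hu hv.
have Su : S (i + u * m)%N by apply/hu.
rewrite /partner in hv; case: (leqP i r) hv => ir hv uv.
  have Sv : S (r - i + (q - u) * m)%N by apply/hv; lia.
  apply: nSf; have := Sadd _ _ Su Sv.
  have -> : (i + u * m + (r - i + (q - u) * m) = f)%N; last by [].
  have eq : (q = u + (q - u))%N by lia.
  by rewrite ef {2}eq mulnDl; lia.
have Sv : S (m + r - i + (q.-1 - u) * m)%N by apply/hv; lia.
apply: nSf; have := Sadd _ _ Su Sv.
have -> : (i + u * m + (m + r - i + (q.-1 - u) * m) = f)%N; last by [].
have eq : (q = 1 + u + (q.-1 - u))%N by lia.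
by rewrite ef {2}eq !mulnDl; lia.
Qed.

(** Below the multiplicity both sets contain only 0; any larger [n] has quotient at least 1, so the
    coordinate of its residue decides membership. *)
Lemma kunz_inj_deep (f : nat) (S S' : set nat) :
  deep_semigroups f S -> deep_semigroups f S' ->
  multiplicity S = multiplicity S' ->
  (forall i, (i < multiplicity S)%N ->
    kunz (multiplicity S) f S i = kunz (multiplicity S) f S' i) ->
  S = S'.
Proof.
move=> /deepP + /deepP + mm; rewrite -mm; move: (multiplicity S) => m.
move=> [[m0 _ [Sm Smin] _ Sf] [S0 Sadd]] [[_ _ [Sm' Smin'] _ Sf'] [S0' Sadd']] e.
apply/seteqP; suff h n : S n <-> S' n by split=> n /h.
have [->|n0] := posnP n; first by split.
have [nm|mn] := ltnP n m.
  split=> [/Smin|/Smin'] /(_ n0); rewrite leqNgt nm //.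
rewrite (divn_eq n m) addnC.
have d0 : (0 < n %/ m)%N by rewrite divn_gt0.
have h1 := kunzP (n %% m) m0 Sf (fun x Sx => Sadd _ _ Sx Sm) d0.
have h2 := kunzP (n %% m) m0 Sf' (fun x Sx => Sadd' _ _ Sx Sm') d0.
by apply: (iff_trans h1); rewrite e ?ltn_pmod //; apply: iff_sym.
Qed.

(** * Real estimates of the counts *)

Lemma pair_list_boundR (R : realFieldType) (Q : nat) :
  ((size (pair_list Q.+3))%:R <= 8 * (13 / 8) ^+ Q :> R)%R.
Proof.
have := pair_list_bound Q; rewrite -(ler_nat R) !natrM !natrX => h.
by rewrite expr_div_n mulrA ler_pdivlMr // exprn_gt0.
Qed.

(** With [p = q - 3] the product is at most 8^m (13/8)^(p m + r + 1), where 13/8 = 2 (13/16) and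
    [p m + r >= L]. The rate 13/16 is weakened to 29/32 so that all three cases share one bound. *)
Lemma kunz_bound_real (R : realFieldType) (q r m L : nat) :
  (3 <= q)%N -> (r < m)%N -> (L + 3 * m <= q * m + r)%N ->
  ((size (pair_list q.+1) ^ r.+1 * size (pair_list q) ^ (m - r.+1))%:R
    <= 13 / 8 * 2 ^+ (q * m + r) * (29 / 32) ^+ L :> R)%R.
Proof.
case: q => [|[|[|p]]] // _ rm Ld.
have b1 := pair_list_boundR R p.+1; have b0 := pair_list_boundR R p.
rewrite natrM !natrX.
have c0 n : (0 <= 8 * (13 / 8) ^+ n :> R)%R by rewrite mulr_ge0 ?exprn_ge0 //; lra.
have h1 := lerXn2r r.+1 (ler0n _ _) (c0 _) b1.
have h0 := lerXn2r (m - r.+1) (ler0n _ _) (c0 _) b0.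
apply: le_trans (ler_pM _ _ h1 h0) _; rewrite ?exprn_ge0 //.
have em : m = (r.+1 + (m - r.+1))%N by lia.
have -> : (p.+3 * m + r = 3 * m + (p * m + r))%N by lia.
have -> : ((8 * (13 / 8) ^+ p.+1) ^+ r.+1 * (8 * (13 / 8) ^+ p) ^+ (m - r.+1) =
   8 ^+ m * (13 / 8 * (13 / 8) ^+ (p * m + r)) :> R)%R.
  rewrite -exprS; move: (13 / 8)%R => c.
  rewrite !exprMn -!exprM mulrACA -!exprD -em; congr (_ * _ ^+ _)%R.
  by rewrite [in RHS]em; nia.
have -> : (13 / 8 : R)%R = (2 * (13 / 16))%R by lra.
rewrite [in leLHS]exprMn [in leRHS]exprD exprM (_ : 2 ^+ 3 = 8 :> R)%R; last by ring.
have h : ((13 / 16) ^+ (p * m + r) <= (29 / 32) ^+ L :> R)%R.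
  apply: (@le_trans _ _ ((29 / 32) ^+ (p * m + r)))%R.
    by apply: lerXn2r; rewrite ?nnegrE; lra.
  by apply: ler_wiXn2l; [lra|lra|nia].
set x := (8 ^+ m)%R; set y := (2 ^+ _)%R; set z := (_ ^+ (_ + _))%R in h *.
have x0 : (0 <= x)%R by rewrite exprn_ge0.
have y0 : (0 <= y)%R by rewrite exprn_ge0.
have := ler_wpM2l (mulr_ge0 x0 y0) h; set w := (_ ^+ L)%R; lra.
Qed.

Lemma gap_bound_real (R : realFieldType) (r m L : nat) : (r + L < m)%N ->
  ((13 ^ r.+1 * 6 ^ L * 8 ^ (m - r.+1 - L))%:R
    <= 13 / 8 * 2 ^+ (3 * m + r) * (29 / 32) ^+ L :> R)%R.
Proof.
move=> rm; rewrite !natrM !natrX; set n := (m - r.+1 - L)%N.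
(* Thus 2^(3m+r) = 8 * 16^r * 8^L * 8^n. Of the [r + 1] factors 13, [r] are compared with 16 and the
   last with 8, whence the constant 13/8. *)
have -> : (3 * m + r = 3 + (4 * r + (3 * L + 3 * n)))%N by lia.
rewrite 3!exprD !exprM exprS.
have -> : (2 ^+ 3 = 8 :> R)%R by ring.
have -> : (2 ^+ 4 = 16 :> R)%R by ring.
have h1 : (13 ^+ r <= 16 ^+ r :> R)%R by apply: lerXn2r; rewrite ?nnegrE; lra.
have h2 : (6 ^+ L <= 8 ^+ L * (29 / 32) ^+ L :> R)%R.
  by rewrite -exprMn; apply: lerXn2r; rewrite ?nnegrE; lra.
have h := ler_pM (exprn_ge0 r (ler0n R 13)) (exprn_ge0 L (ler0n R 6)) h1 h2.
have := ler_wpM2r (exprn_ge0 n (ler0n R 8)) h; lra.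
Qed.

(** Here 58/64 = 29/32 exactly: this case dictates the common rate. *)
Lemma shift_bound_real (R : realFieldType) (r m L : nat) : (r + (L + L) < m)%N ->
  ((13 ^ r.+1 * 58 ^ L * 8 ^ (m - r.+1 - (L + L)))%:R
    <= 13 / 8 * 2 ^+ (3 * m + r) * (29 / 32) ^+ L :> R)%R.
Proof.
move=> rm; rewrite !natrM !natrX; set n := (m - r.+1 - (L + L))%N.
have -> : (3 * m + r = 3 + (4 * r + (6 * L + 3 * n)))%N by lia.
rewrite 3!exprD !exprM exprS.
have -> : (2 ^+ 3 = 8 :> R)%R by ring.
have -> : (2 ^+ 4 = 16 :> R)%R by ring.
have -> : (2 ^+ 6 = 64 :> R)%R by ring.
have h1 : (13 ^+ r <= 16 ^+ r :> R)%R by apply: lerXn2r; rewrite ?nnegrE; lra.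
have -> : (58 ^+ L = 64 ^+ L * (29 / 32) ^+ L :> R)%R.
  by rewrite -exprMn; congr (_ ^+ _)%R; lra.
have c0 : (0 <= 64 ^+ L * (29 / 32) ^+ L * 8 ^+ n :> R)%R.
  by rewrite !mulr_ge0 ?exprn_ge0 //; lra.
have := ler_wpM2r c0 h1; lra.
Qed.

(** * Bounds over classes of equal multiplicity and window index *)

(* The value L means that no element of (L, 2L] has Kunz coordinate 1. *)
Definition window_index (L : nat) (S : set nat) : nat :=
  find (fun j => `[< S (L.+1 + j + multiplicity S)%N >]) (iota 0 L).

(** Fixing the window index gives all members of the class the same [a]. With [L = f / 30] rounded
    down, the general count covers [L + 3 m <= f]; otherwise [w < L] leads to the shift count and
    [w >= L] to the gap count. *)
Lemma deep_class_bound (R : realFieldType) (f m w : nat) (s : seq (set nat)) :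
  uniq s -> (forall S, S \in s -> deep_semigroups f S) ->
  (forall S, S \in s -> multiplicity S = m) ->
  (forall S, S \in s -> window_index (f %/ 30) S = w) ->
  ((size s ^ 2)%:R <= 13 / 8 * 2 ^+ f * (29 / 32) ^+ (f %/ 30) :> R)%R.
Proof.
case: s => [|S0 s0].
  by move=> _ _ _ _; rewrite !mulr_ge0 ?exprn_ge0 //; lra.
set s := (S0 :: s0); have S0s : S0 \in s by rewrite mem_head.
move: s S0s => s S0s us sD sm sw.
have [[m0 m3 _ _ _] _] := deepP (sD _ S0s); rewrite (sm _ S0s) in m0 m3.
have inj : {in s &, forall S S',
    (forall i, (i < m)%N -> kunz m f S i = kunz m f S' i) -> S = S'}.
  move=> S S' Ss Ss' e; apply: (kunz_inj_deep (sD _ Ss) (sD _ Ss')).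
    by rewrite !sm.
  by rewrite sm.
have bd S : S \in s -> kunz_bounded m (f %/ m) (f %% m) (kunz m f S).
  by move=> Ss; have := kunz_bounded_deep (sD _ Ss); rewrite sm.
have kP S i j : S \in s -> (0 < j)%N ->
    S (i + j * m)%N <-> (kunz m f S i <= j)%N.
  move=> Ss; have [[_ _ [Sm _] _ Sf] [_ Sadd]] := deepP (sD _ Ss).
  by apply: kunzP => // n Sn; apply: Sadd => //; rewrite -(sm _ Ss).
have rm := ltn_pmod f m0; have ef := divn_eq f m.
have q3 : (3 <= f %/ m)%N by rewrite leq_divRL.
have L30 := leq_divM f 30; move: (f %/ 30)%N L30 sw => L L30 sw.
have [Ld|dL] := leqP (L + 3 * m) f.
  have h := @kunz_bound_real R _ _ _ L q3 rm; rewrite -ef in h.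
  apply: le_trans (h Ld); rewrite ler_nat.
  exact: (kunz_count rm us inj bd).
have q4 : (f %/ m = 3)%N by apply/eqP; rewrite eqn_leq q3 -ltnS ltn_divLR //; lia.
rewrite q4 in ef bd; move: (f %% m)%N rm ef bd => r rm ef bd.
rewrite ef; have rL : (r <= L)%N by lia.
(* From [30 L <= f < L + 3 m] follows [29 L < 3 m]. *)
have Lm : (7 * L < m)%N by lia.
have [wL|Lw] := ltnP w L.
  have rLm : (r + (L + L) < m)%N by lia.
  apply: le_trans (shift_bound_real R rLm); rewrite ler_nat; apply: (kunz_count_shift (a := (L.+1 + w)%N)) inj bd _ => //.
    by lia.
  move=> S i Ss ia ki; rewrite -kP //.
  (* With [a = L + 1 + w], both [i + m] and [a + m] lie in [S], hence so does [i + a + 2 m]. *)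
  have -> : (i + (L.+1 + w) + 2 * m = i + 1 * m + (L.+1 + w + m))%N by lia.
  have [_ [_ Sadd]] := deepP (sD _ Ss); apply: Sadd.
    by apply/kP => //; rewrite ki.
  have := sw _ Ss; rewrite /window_index sm //; set p := fun j => _ => pw.
  have hp : has p (iota 0 L) by rewrite has_find pw size_iota.
  by have := nth_find 0%N hp; rewrite pw nth_iota // => /asboolP.
apply: le_trans; last by apply: gap_bound_real; lia.
rewrite ler_nat; apply: kunz_count_gap inj bd _ => //.
move=> S i Ss iL ki.
have Si : S (i + m)%N by rewrite -[m]mul1n; apply/kP => //; rewrite ki.
have := sw _ Ss; rewrite /window_index sm //; set p := fun j => _ => pw.
have : has p (iota 0 L).
  apply/hasP; exists (i - L.+1)%N; first by rewrite mem_iota; lia.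
  by apply/asboolP; rewrite subnKC //; lia.
by rewrite has_find pw size_iota ltnNge Lw.
Qed.

Lemma deep_card_bound (R : realFieldType) (f : nat) :
  ((#|` fset_set (deep_semigroups f)|)%:R <=
   (f.+1 * (f %/ 30).+1)%:R * (3 * (61 / 64) ^+ (f %/ 30) * 2 ^+ fbar f) :> R)%R.
Proof.
set L := (f %/ 30)%N.
(* Multiplicity and window index are packed into one number in base [L + 1]; division with remainder
   recovers them. *)
pose l S := (multiplicity S * L.+1 + window_index L S)%N.
have sD S : S \in fset_set (deep_semigroups f) -> deep_semigroups f S.
  by rewrite in_fset_set ?inE //; exact: finite_deep_semigroups.
have wL S : (window_index L S < L.+1)%N.
  by rewrite ltnS -[leqRHS](size_iota 0 L) find_size.
apply: (size_le_classes (l := l)) => [|j].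
  apply/allP => S /sD /deepP[[_ m3 _ _ _] _].
  have mf : ((multiplicity S).+1 * L.+1 <= f.+1 * L.+1)%N by rewrite leq_mul2r; lia.
  by apply: leq_trans mf; rewrite mulSnr ltn_add2l.
set s := [seq _ <- _ | _].
have sj S : S \in s -> l S = j /\ deep_semigroups f S.
  by rewrite mem_filter => /andP[/eqP + /sD].
have h : ((size s ^ 2)%:R <= 13 / 8 * 2 ^+ f * (29 / 32) ^+ L :> R)%R.
  apply: (@deep_class_bound R f (j %/ L.+1) (j %% L.+1)).
  - exact/filter_uniq/fset_uniq.
  - by move=> S /sj[].
  - by move=> S /sj[<- _]; rewrite /l divnMDl // divn_small ?addn0.
  - by move=> S /sj[<- _]; rewrite /l modnMDl modn_small.
have c0 : (0 <= 3 * (61 / 64) ^+ L * 2 ^+ fbar f :> R)%R.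
  by rewrite !mulr_ge0 ?exprn_ge0 //; lra.
rewrite -(@ler_pXn2r _ 2) ?nnegrE // -(natrX R (size s)).
apply: le_trans h _.
(* The squares are compared: [f <= 2 * fbar f + 2] costs a factor 4, 4 * 13/8 is at most 3^2, and
   29/32 is at most (61/64)^2. *)
have h1 : (2 ^+ f <= 4 * (2 ^+ fbar f) ^+ 2 :> R)%R.
  rewrite -exprM (_ : 4 = 2 ^+ 2 :> R)%R; last by ring.
  by rewrite -exprD; apply: ler_weXn2l; [lra|rewrite /fbar; lia].
have h2 : ((29 / 32) ^+ L <= ((61 / 64) ^+ L) ^+ 2 :> R)%R.
  by rewrite exprAC; apply: lerXn2r; rewrite ?nnegrE; lra.
have p1 : (0 <= 2 ^+ f :> R)%R by rewrite exprn_ge0.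
have p2 : (0 <= (29 / 32) ^+ L :> R)%R by rewrite exprn_ge0; lra.
have := ler_pM p1 p2 h1 h2.
set x := (2 ^+ f)%R; set w := ((29 / 32) ^+ L)%R.
set y := (2 ^+ fbar f)%R; set z := ((61 / 64) ^+ L)%R => hx.
have yz : (0 <= y ^+ 2 * z ^+ 2)%R by rewrite mulr_ge0 ?sqr_ge0.
lra.
Qed.

(** * Absorbing the polynomial factor and passing to the limit *)

(** This is Bernoulli's inequality. The base 67/66 is close enough to 1 that (67/66)^2 (61/64) <=
    66/67, so two such factors still leave geometric decay. *)
Lemma succn_le_expr (R : realFieldType) (L : nat) :
  ((L.+1)%:R <= 66 * (67 / 66) ^+ L :> R)%R.
Proof.
have h : (L%:R + 66 <= 66 * (67 / 66) ^+ L :> R)%R.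
  elim: L => [|L IH]; first by rewrite expr0; lra.
  have L0 : (0 <= L%:R :> R)%R by [].
  by rewrite exprS -natr1; lra.
rewrite -natr1; lra.
Qed.

Lemma deep_ratio_bound (R : realFieldType) (f : nat) :
  ((#|` fset_set (deep_semigroups f)|)%:R / 2 ^+ fbar f <=
   90 * 66 ^+ 2 * (66 / 67) ^+ (f %/ 30) :> R)%R.
Proof.
have p0 : (0 < 2 ^+ fbar f :> R)%R by rewrite exprn_gt0.
rewrite ler_pdivrMr //; apply: le_trans (deep_card_bound R f) _.
rewrite mulrA ler_pM2r //; set L := (f %/ 30)%N.
(* The number of classes is at most 30 (L + 1)^2; together with the factor 3 of the class bound this
   gives the 90. *)
have fL : (f.+1 * L.+1 <= 30 * (L.+1 * L.+1))%N by rewrite /L; nia.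
have {fL} : ((f.+1 * L.+1)%:R <= 30 * (L.+1%:R * L.+1%:R) :> R)%R.
  by rewrite -!natrM ler_nat.
have := succn_le_expr R L; set a := (L.+1)%:R%R; set v := (_ ^+ L)%R => av.
set b := (_%:R)%R => ba.
have a0 : (0 <= a)%R by [].
have aa := ler_pM a0 a0 av av.
have t0 : (0 <= (61 / 64) ^+ L :> R)%R by rewrite exprn_ge0; lra.
have vt : (v * v * (61 / 64) ^+ L <= (66 / 67) ^+ L)%R.
  by rewrite /v -!exprMn; apply: lerXn2r; rewrite ?nnegrE; lra.
have h : (b <= 30 * (66 * v * (66 * v)))%R by lra.
have := ler_wpM2r t0 h; lra.
Qed.

Local Open Scope ring_scope.

Theorem corollary2p1p1 (R : realType) :
  ((#|` fset_set (deep_semigroups f)|)%:R / 2 ^+ fbar f : R)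
    @[f --> \oo] --> (0 : R).
Proof.
apply: (@squeeze_cvgr _ _ _ _ (fun=> 0%R)
  (fun f => 90 * 66 ^+ 2 * (66 / 67) ^+ (f %/ 30))%R).
- apply: nearW => f; rewrite deep_ratio_bound andbT.
  by rewrite divr_ge0 // exprn_ge0.
- exact: cvg_cst.
- rewrite -[X in _ --> X](mulr0 (90 * 66 ^+ 2)%R); apply: cvgMr.
  have c : ((66 / 67 : R) ^+ n)%R @[n --> \oo] --> (0 : R)%R.
    by apply: cvg_expr; rewrite ger0_norm; lra.
  apply: (cvg_comp _ _ _ c); apply/cvgnyPge => A.
  exists (A * 30)%N => // n /= An; by rewrite leq_divRL.
Qed.
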